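(* Let $d\ge 2$ and let $P_2(L)$ be the number of polygons in the hypercube of side $L$ in $\mathbb{Z}^d$ that have at least one edge in each of the two faces of at least one pair of opposite faces of the hypercube. Then $$\lim_{L\to\infty}\frac{1}{L^d}\log P_2(L)=\log\lambda_d ,$$ where $\log\lambda_d=\lim_{L\to\infty}L^{-d}\log C(L)$ and $C(L)$ is the number of self-avoiding walks that cross the hypercube of side $L$ from one corner vertex to the diagonally opposite corner vertex.
   Context: For a positive integer $L$, the hypercube of side $L$ is the subgraph of the lattice $\mathbb{Z}^d$ (nearest-neighbour edges, coordinates $(x_1,\dots,x_d)$) induced by the vertex set $\{0,1,\dots,L\}^d$. Its pairs of opposite faces are $x_k=0$ and $x_k=L$, for $k=1,\dots,d$; an edge is in a face if both its endpoints are. A self-avoiding walk is a nearest-neighbour lattice path that visits no vertex more than once. $C(L)$ counts the self-avoiding walks that stay in the hypercube of side $L$, start at a fixed corner vertex (say $(0,\dots,0)$) and end at the diagonally opposite corner vertex (say $(L,\dots,L)$). The limit $\lim_{L\to\infty}L^{-d}\log C(L)$ exists and is finite; $\lambda_d$ is defined by setting this limit equal to $\log\lambda_d$. A polygon is a simple closed cycle, regarded as an (unrooted, unoriented) subgraph of the lattice; polygons are counted as distinct subgraphs of the fixed hypercube (translates are counted as different). *)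

(* Defs.v *)
From HB Require Import structures.
From mathcomp Require Import all_boot all_order all_algebra.
From mathcomp Require Import all_classical all_reals all_analysis.
Set Implicit Arguments.
Unset Strict Implicit.
Unset Printing Implicit Defensive.
Import Order.TTheory GRing.Theory Num.Theory.
Import numFieldNormedType.Exports.

(* Vertices of the hypercube {0, ..., L}^d. *)
Definition vertex (d L : nat) := {ffun 'I_d -> 'I_L.+1}.

(* Nearest neighbours: the l^1 distance in Z^d is 1. *)
Definition adj (d L : nat) : rel (vertex d L) :=
  fun x y => (\sum_(k < d) `|x k - y k|%N)%N == 1%N.

Definition corner0 (d L : nat) : vertex d L := [ffun _ => ord0].
Definition cornerL (d L : nat) : vertex d L := [ffun _ => ord_max].

(* n-step self-avoiding walks from corner0 to cornerL; p lists the vertices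
   visited after the initial one. *)
Definition crossing_walks (d L n : nat) : {set n.-tuple (vertex d L)} :=
  [set p : n.-tuple (vertex d L) |
    [&& path (@adj d L) (corner0 d L) p,
        uniq (corner0 d L :: p)
      & last (corner0 d L) p == cornerL d L]].

(* No length is missed: a self-avoiding walk in the hypercube has fewer steps
   than there are vertices. *)
Definition C (d L : nat) : nat :=
  (\sum_(n < #|{: vertex d L}|) #|crossing_walks d L n|)%N.

(* Edges are unordered pairs, and subgraphs without isolated vertices are
   represented by their sets of edges. *)
Definition cycle_edges (d L : nat) (c : seq (vertex d L)) :
    {set {set vertex d L}} :=
  [set [set x; next c x] | x in c].

(* A polygon is the edge set of some simple closed cycle.  Cycles of length 2
   (one edge traversed back and forth) must be excluded explicitly; the bound
   on n loses nothing since the vertices of c are distinct. *)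
Definition is_polygon (d L : nat) (E : {set {set vertex d L}}) : bool :=
  [exists n : 'I_(#|{: vertex d L}|.+1),
    [exists c : n.-tuple (vertex d L),
      [&& (2 < n)%N, uniq c, cycle (@adj d L) c & E == cycle_edges c]]].

Definition face (d L : nat) (k : 'I_d) (a : 'I_L.+1) : {set vertex d L} :=
  [set x : vertex d L | x k == a].

Definition has_edge_in (d L : nat) (E : {set {set vertex d L}})
    (F : {set vertex d L}) : bool :=
  [exists e in E, e \subset F].

Definition P2 (d L : nat) : nat :=
  #|[set E : {set {set vertex d L}} | is_polygon E &&
      [exists k : 'I_d, has_edge_in E (face k ord0) &&
                        has_edge_in E (face k ord_max)]]|.

(* Main.v *)
Require Import Defs.
From HB Require Import structures.
From mathcomp Require Import all_boot all_order all_algebra.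
From mathcomp Require Import all_classical all_reals all_analysis.
From mathcomp Require Import zify ring.
Import Order.TTheory GRing.Theory Num.Theory.
Import numFieldNormedType.Exports.

Set Implicit Arguments.
Unset Strict Implicit.
Unset Printing Implicit Defensive.

(** Up to a polynomial factor, P2(L) and C(L) agree after changing L by one;
    since log L = o(L^d), the limits coincide.  Embed the cube of side L into
    the cube of side L+1 by shifting one coordinate x_k by 1: this leaves free
    the boundary layer formed by the face x_k = 0 and the faces x_j = L+1 with
    j <> k.
    - P2(L) <= d N^2 C(L+1), with N the number of vertices: remove from a
      polygon an edge {u, v} of the face x_k = 0, where v = u + e_i, and join
      u to the corner 0 by a decreasing path and v to the opposite corner by
      an increasing path, both in the free layer.  These two paths are
      disjoint because they are separated by their i-th coordinates.  The
      polygon is recovered from k, the walk, and the position of the polygon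
      in the walk.
    - C(L) <= P2(L+1) for L >= 1: close up all embedded crossing walks by the
      same path in the free layer; the walk is recovered from the edges of
      the polygon inside the embedded cube. *)

(** * Adjacency in the cube and coordinatewise increasing paths *)

Section Cube.
Context {d L : nat}.
Implicit Types (x y z a b : vertex d L) (i j k : 'I_d).

Definition step i x y := forall t, y t = x t + (t == i) :> nat.

Lemma adjP x y :
  reflect ((exists i, step i x y) \/ (exists i, step i y x)) (adj x y).
Proof.
apply: (iffP idP).
- rewrite /adj => /eqP h.
  have [i hi] : exists i, x i != y i :> nat.
    apply/existsP; apply: contra_eqT h => /existsPn h.
    by rewrite big1 // => t _; move: (h t) => /negPn/eqP ->; rewrite distnn.
  move: h; rewrite (bigD1 i) //= => h.
  have hxy t : t != i -> x t = y t :> nat.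
    move=> ti; have : (\sum_(k < d | k != i) `|x k - y k| == 0)%N.
      by move: hi h; set S := (\sum_(_ < _ | _) _)%N; lia.
    rewrite sum_nat_eq0 => /forallP /(_ t); rewrite ti /= => /eqP; lia.
  have : (y i = x i + 1 :> nat) \/ (x i = y i + 1 :> nat) by move: hi h; lia.
  case=> e; [left|right]; exists i => t; case: eqVneq => [->|/hxy]; lia.
- move=> h; suff /eqP : (\sum_(k < d) `|x k - y k| = 1)%N by [].
  case: h => -[i hi]; rewrite (bigD1 i) //= big1 ?hi ?eqxx ?addn0; try lia.
    by move=> t /negbTE ti; rewrite hi ti; lia.
  by move=> t /negbTE ti; rewrite hi ti; lia.
Qed.

Lemma adj_sym : symmetric (@adj d L).
Proof. by move=> x y; congr (_ == _); apply: eq_bigr => k _; rewrite distnC. Qed.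

Definition lev x y := [forall t, x t <= y t].

Lemma levP x y : reflect (forall t, x t <= y t) (lev x y).
Proof. exact: forallP. Qed.

Lemma vertexP x y : (forall t, x t = y t :> nat) -> x = y.
Proof. by move=> h; apply/ffunP => t; apply: val_inj; rewrite /= h. Qed.

(* Moving in direction [j] first keeps the path on the boundary: it stays in
   the face [x_k = 0] until it has reached the hyperplane [x_j = b_j]. *)
Lemma monotone_path j k a b : lev a b -> k != j ->
    a k = 0 :> nat \/ a j = b j :> nat ->
  exists p, [/\ path (@adj d L) a p, last a p = b, uniq (a :: p) &
    {in a :: p, forall x, [/\ lev a x, lev x b &
       x k = 0 :> nat \/ x j = b j :> nat]}].
Proof.
move=> /levP ab kj.
have [n] := ubnP (\sum_t (b t - a t)); elim: n => // n IH in a ab *.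
move=> hn hab.
have [->|ne] := eqVneq a b.
  exists [::]; split=> // x; rewrite inE => /eqP ->; split.
  - by apply/levP.
  - by apply/levP.
  - by right.
have [i [lti hi]] : exists i, a i < b i /\ (a j < b j -> i = j).
  case: (ltnP (a j) (b j)) => hj; first by exists j.
  have [i hi] : exists i, a i < b i.
    apply/existsP; apply: contraR ne => /existsPn h; apply/eqP/vertexP => t.
    by move: (h t) (ab t); lia.
  by exists i.
have ltL : (a i).+1 < L.+1 by apply: leq_ltn_trans (ltn_ord (b i)).
pose a' : vertex d L := [ffun t => if t == i then Ordinal ltL else a t].
have sa' : step i a a'.
  by move=> t; rewrite ffunE; case: eqVneq => [->|] /=; lia.
have ab' t : a' t <= b t.
  by rewrite sa'; case: eqVneq => [->|_]; move: (ab t); lia.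
have hn' : \sum_t (b t - a' t) < n.
  rewrite -ltnS; apply: leq_trans hn; rewrite ltnS.
  rewrite (bigD1 i) //= [X in _ < X](bigD1 i) //= sa' eqxx.
  rewrite -addSn leq_add //; first by lia.
  by apply: leq_sum => t ti; rewrite sa'; lia.
have hab' : a' k = 0 :> nat \/ a' j = b j :> nat.
  move: (ab j) hab; rewrite leq_eqVlt => /orP[/eqP e _|ltj].
    by right; move: (ab' j); rewrite sa'; lia.
  have ij := hi ltj; subst i; case=> h; last by lia.
  by left; rewrite sa' h (negbTE kj).
have [p [p1 p2 p3 p4]] := IH a' ab' hn' hab'.
have aa' : lev a a' by apply/levP => t; rewrite sa' leq_addr.
exists (a' :: p); split.
- by rewrite /= p1 andbT; apply/adjP; left; exists i.
- by [].
- rewrite cons_uniq p3 andbT; apply/negP => /p4[/levP/(_ i)].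
  by rewrite sa' eqxx; lia.
- move=> x; rewrite inE => /orP[/eqP ->|/p4[h1 h2 h3]].
    by split=> //; apply/levP.
  split=> //; apply/levP => t; apply: leq_trans (levP _ _ aa' t) _.
  exact/levP.
Qed.

End Cube.

(** * Edge lists of walks and cycles *)

Section Edges.
Context {V : finType}.
Implicit Types (x y z : V) (p q c : seq V) (e : {set V}).

Definition path_edges x p : seq {set V} :=
  pairmap (fun a b => [set a; b]%SET) x p.

Lemma path_edges_incident x p e : x \notin p -> e \in path_edges x p ->
  x \in e -> exists y q, p = y :: q /\ e = [set x; y]%SET.
Proof.
case: p => // y q; rewrite /= !inE negb_or => /andP[xy xq] /predU1P[->|].
  by exists y, q.
move=> he xe; exfalso; move: he.
elim: q y xy xq => //= z q IH y xy; rewrite inE negb_or => /andP[xz xq].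
rewrite inE => /predU1P[ee|]; last exact: IH.
by move: xe; rewrite ee !inE (negbTE xy) (negbTE xz).
Qed.

(** The only edge at [x] is the first one, so it determines the first step; deleting it leaves two
    walks from [y] with equal edge sets. *)
Lemma path_edges_inj x p q : uniq (x :: p) -> uniq (x :: q) ->
  path_edges x p =i path_edges x q -> p = q.
Proof.
elim: p x q => [|y p IH] x [|z q] //=.
- by move=> _ _ /(_ [set x; z]%SET); rewrite !inE eqxx.
- by move=> _ _ /(_ [set x; y]%SET); rewrite !inE eqxx.
move=> /andP[xp up] /andP[xq uq] h.
have yz : y = z.
  have := h [set x; y]%SET; rewrite inE eqxx => /esym /(@path_edges_incident x (z :: q)).
  case; [by [] | by rewrite !inE eqxx |].
  move=> _ [_ [[<- _]] /setP /(_ y)]; rewrite !inE eqxx orbT.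
  by case: eqVneq => [e|_ /esym/eqP//]; rewrite e mem_head in xp.
subst z; congr (_ :: _); apply: (IH _ _ up uq) => e.
have fresh r : x \notin y :: r -> uniq (y :: r) -> [set x; y]%SET \notin path_edges y r.
  move=> xr ur; apply/negP => he.
  have [||w [s [er /setP/(_ x)]]] := path_edges_incident _ he.
  - by case/andP: ur.
  - by rewrite !inE eqxx orbT.
  - move: xr; rewrite er !inE eqxx => /norP[/negbTE -> /norP[/negbTE -> _]] //.
have := h e; rewrite !inE; case: eqVneq => //= -> _.
by rewrite (negbTE (fresh p xp up)) (negbTE (fresh q xq uq)).
Qed.

(** Each edge has its first endpoint in [x :: p], hence outside [S]. The final vertex [z] is exempt
    because a closing path ends back in the embedded cube. *)
Lemma path_edges_not_subset (S : {pred V}) x p z e :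
  x \notin S -> {in p, forall y, y \notin S} ->
  e \in path_edges x (rcons p z) -> ~~ (e \subset S).
Proof.
elim: p x => [|a p IH] x xS pS; rewrite /= inE.
  move=> /eqP ->; apply: contra xS => /fintype.subsetP; apply.
  by rewrite !inE eqxx.
case/predU1P => [->|].
  by apply: contra xS => /fintype.subsetP; apply; rewrite !inE eqxx.
apply: IH; first by apply: pS; rewrite mem_head.
by move=> y yp; apply: pS; rewrite inE yp orbT.
Qed.

Lemma path_edges_subset x p e :
  e \in path_edges x p -> {subset e <= x :: p}.
Proof.
elim: p x => [|y p IH] x //=; rewrite inE => /predU1P[->|/IH h] z.
  by rewrite !inE => /orP[] /eqP ->; rewrite eqxx ?orbT.
by move=> /h; rewrite [in X in _ -> X]inE => ->; rewrite orbT.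
Qed.

Lemma map_next x p : uniq (x :: p) ->
  [seq next (x :: p) y | y <- x :: p] = rcons p x.
Proof.
move=> u; apply: (@eq_from_nth _ x); first by rewrite size_map size_rcons.
rewrite size_map => i ilt; rewrite (nth_map x) // next_nth mem_nth //.
rewrite index_uniq // nth_rcons; case: ltngtP => // h.
  by move: ilt h; rewrite /=; lia.
by rewrite nth_default // h.
Qed.

Lemma path_edges_rcons x p z : path_edges x (rcons p z) =
  [seq [set a.1; a.2]%SET | a <- zip (x :: p) (rcons p z)].
Proof. by elim: p x => //= y p IH x; rewrite IH. Qed.

End Edges.

Section CycleEdges.
Context {d L : nat}.
Implicit Types (x y z : vertex d L) (c p q : seq (vertex d L)).

(** Edge lists split along concatenation, which later separates a walk from the path that closes
    it. *)
Lemma cycle_edges_cons x p : uniq (x :: p) ->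
  cycle_edges (x :: p) =i path_edges x (rcons p x).
Proof.
move=> u e.
have -> : path_edges x (rcons p x) = [seq [set y; next (x :: p) y]%SET | y <- x :: p].
  rewrite path_edges_rcons -map_next //.
  elim: (x :: p) (next _) => //= y q IH f; by rewrite IH.
by apply/imsetP/mapP => -[y yc ->]; exists y.
Qed.

End CycleEdges.

(** * Cutting a polygon at an edge of a face *)

Section Cut.
Context {d L : nat}.
Implicit Types (x y z : vertex d L) (c p q : seq (vertex d L)).

Lemma cycle_edges_rot n c : uniq c -> cycle_edges (rot n c) = cycle_edges c.
Proof.
move=> u; apply/setP => e; apply/imsetP/imsetP => -[y yc ->]; exists y;
  by rewrite ?mem_rot // ?next_rot //; rewrite mem_rot in yc.
Qed.

Lemma cycle_edges_rev c : uniq c -> cycle_edges (rev c) = cycle_edges c.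
Proof.
move=> u; apply/setP => e; apply/imsetP/imsetP => -[y yc ->].
  exists (prev c y); first by rewrite mem_prev -mem_rev.
  by rewrite next_rev // next_prev // finset.setUC.
exists (next c y); first by rewrite mem_rev mem_next.
by rewrite next_rev // prev_next // finset.setUC.
Qed.

Lemma polygonP (E : {set {set vertex d L}}) :
  reflect (exists c, [/\ 2 < size c, uniq c, cycle (@adj d L) c
                       & E = cycle_edges c])
          (is_polygon E).
Proof.
apply: (iffP existsP) => [[n /existsP[c /and4P[n2 u cc /eqP ->]]]|].
  by exists c; rewrite size_tuple.
move=> [c [c2 u cc ->]].
have cn : size c < #|{: vertex d L}|.+1 by rewrite ltnS -(card_uniqP u) max_card.
exists (Ordinal cn); apply/existsP; exists (in_tuple c).
by rewrite u cc c2 eqxx.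
Qed.

(** A rotation makes the chosen edge the closing edge of the cycle; a reversal, if needed, makes the
    last vertex its upper endpoint. *)
Lemma polygon_cut (E : {set {set vertex d L}}) k :
  is_polygon E -> has_edge_in E (face k ord0) ->
  exists x s i, [/\ E = cycle_edges (x :: s), uniq (x :: s),
    path (@adj d L) x s, step i x (last x s) &
    x k = 0 :> nat /\ last x s k = 0 :> nat].
Proof.
move=> /polygonP[c [c2 u cc ->]] /existsP[_ /andP[/imsetP[y yc ->]]].
set w := next c y => /fintype.subsetP sub.
have yk : y k = 0 :> nat.
  by have := sub y; rewrite !inE eqxx => /(_ isT) /eqP ->.
have wk : w k = 0 :> nat.
  by have := sub w; rewrite !inE eqxx orbT => /(_ isT) /eqP ->.
have /adjP yw : adj y w by apply: next_cycle.
have wc : w \in c by rewrite mem_next.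
have [n s rc] := rot_to wc.
have uws : uniq (w :: s) by rewrite -rc rot_uniq.
(* [next c] is injective and maps both sides to [w]. *)
have ls : last w s = y.
  apply: (can_inj (prev_next u)); rewrite -[RHS]/w -(next_rot n u) rc.
  rewrite -(last_map (next (w :: s))).
  have := congr1 (last w) (map_next uws); rewrite last_rcons /=.
  by case: (s).
have ce : cycle_edges c = cycle_edges (w :: s) by rewrite -rc cycle_edges_rot.
have cws : cycle (@adj d L) (w :: s) by rewrite -rc rot_cycle.
case: yw => -[i st].
(* Here [w] lies above [y], so the cycle is read backwards from [y]. *)
- have s0 : 0 < size s by move: c2; rewrite -(size_rot n c) rc /=; case: (size s).
  case/lastP: s => // s y' in s0 rc uws ls ce cws *.
  rewrite last_rcons in ls; subst y'.
  exists y, (rcons (rev s) w), i.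
  have er : y :: rcons (rev s) w = rev (w :: rcons s y).
    by rewrite rev_cons rev_rcons.
  have : cycle (@adj d L) (y :: rcons (rev s) w).
    rewrite er rev_cycle; move: cws; rewrite /cycle.
    by rewrite (eq_path (e' := fun x z => adj z x)) // => a b; rewrite adj_sym.
  rewrite /= rcons_path => /andP[pp _].
  split; rewrite ?last_rcons //.
  - by rewrite ce -(cycle_edges_rev uws) -er.
  - by have := uws; rewrite -rev_uniq -er.
- exists w, s, i; rewrite ls; split=> //.
  by move: cws; rewrite /= rcons_path => /andP[].
Qed.

End Cut.

(** * Crossing walks of all lengths *)

Section Walks.
Context (d L : nat).

Definition crossing (p : seq (vertex d L)) :=
  [&& path (@adj d L) (corner0 d L) p, uniq (corner0 d L :: p)
    & last (corner0 d L) p == cornerL d L].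

(** One finite type for all lengths turns the sum in [C] into a single cardinality. *)
Definition walk_space := {n : 'I_#|{: vertex d L}| & n.-tuple (vertex d L)}.

Definition walks : {set walk_space} := [set t : walk_space | crossing (tagged t)]%SET.

Lemma C_card : C d L = #|walks|.
Proof.
rewrite /C; under eq_bigr do rewrite -sum1_card.
rewrite sig_big_dep -sum1_card; apply: eq_bigl => -[n p].
by rewrite /= !inE.
Qed.

Lemma crossing_size p : crossing p -> size p < #|{: vertex d L}|.
Proof.
case/and3P => _ /card_uniqP e _.
by apply: leq_trans (max_card [in corner0 d L :: p]); rewrite e.
Qed.

Lemma crossing_in_walks p : crossing p ->
  exists2 t : walk_space, t \in walks & val (tagged t) = p.
Proof.
move=> hp; exists (Tagged (fun n : 'I_#|{: vertex d L}| => n.-tuple (vertex d L))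
  (in_tuple p : (Ordinal (crossing_size hp)).-tuple (vertex d L))) => //.
by rewrite inE.
Qed.

Lemma walk_space_inj (t t' : walk_space) :
  val (tagged t) = val (tagged t') -> t = t'.
Proof.
case: t t' => [n p] [n' p'] /= h.
have e : n = n' by apply: val_inj; rewrite /= -(size_tuple p) h size_tuple.
by subst n'; congr Tagged; apply: val_inj.
Qed.

End Walks.

(** * The embedding into the cube of side L+1 *)

Section Embedding.
Context {d L : nat}.
Implicit Types (x y : vertex d L) (p : seq (vertex d L)) (i j k : 'I_d).

Definition emb k x : vertex d L.+1 := [ffun t => inord (x t + (t == k))].

Definition unemb k (y : vertex d L.+1) : vertex d L :=
  [ffun t => inord (y t - (t == k))].

(** If x_k = 0, this point lies in the free face, one step below [emb k x]: it is the gate between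
    the free layer and the embedded cube. *)
Definition low x : vertex d L.+1 := [ffun t => inord (x t)].

Lemma embE k x t : emb k x t = x t + (t == k) :> nat.
Proof. by rewrite ffunE inordK //; have := ltn_ord (x t); lia. Qed.

Lemma lowE x t : low x t = x t :> nat.
Proof. by rewrite ffunE inordK //; have := ltn_ord (x t); lia. Qed.

Lemma embK k : cancel (emb k) (unemb k).
Proof.
move=> x; apply: vertexP => t; rewrite ffunE inordK embE ?addnK //.
Qed.

Lemma step_low k x : step k (low x) (emb k x).
Proof. by move=> t; rewrite embE lowE. Qed.

Lemma adj_emb k x y : adj (emb k x) (emb k y) = adj x y.
Proof. by congr (_ == _); apply: eq_bigr => t _; rewrite !embE; lia. Qed.

Lemma path_emb k x p :
  path (@adj d L.+1) (emb k x) (map (emb k) p) = path (@adj d L) x p.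
Proof. by rewrite path_map; apply: eq_path => a b; apply: adj_emb. Qed.

Lemma emb_codom k (y : vertex d L.+1) : y \in codom (emb k) ->
  0 < y k /\ forall j, j != k -> y j <= L.
Proof.
case/codomP => x ->; rewrite embE eqxx; split; first by rewrite addn1.
by move=> j /negbTE jk; rewrite embE jk addn0 -ltnS ltn_ord.
Qed.

Lemma map_emb_codom k p : {in map (emb k) p, forall y : vertex d L.+1, y \in codom (emb k)}.
Proof. by move=> _ /mapP[x _ ->]; apply: codom_f. Qed.

End Embedding.

Lemma corner0E d L t : corner0 d L t = 0 :> nat.
Proof. by rewrite ffunE. Qed.

Lemma cornerLE d L t : cornerL d L t = L :> nat.
Proof. by rewrite ffunE. Qed.

(** * The two inequalities between P2 and C *)

Section Comparison.
Context {d L : nat}.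

Lemma polygon_to_walk (x : vertex d L) s i k :
    uniq (x :: s) -> path (@adj d L) x s -> step i x (last x s) ->
    x k = 0 :> nat -> last x s k = 0 :> nat ->
  exists p q, crossing (p ++ map (emb k) (x :: s) ++ q).
Proof.
move=> u ps st xk yk; set y := last x s in st yk *.
have ki : k != i.
  by apply/eqP => e; have := st k; rewrite e eqxx -e xk yk.
have lev0 (z : vertex d L.+1) : lev (corner0 d L.+1) z.
  by apply/levP => t; rewrite corner0E.
have levL (z : vertex d L.+1) : lev z (cornerL d L.+1).
  by apply/levP => t; rewrite cornerLE -ltnS.
have [A [A1 A2 A3 A4]] := @monotone_path _ _ i k _ (low x) (lev0 _) ki
  (or_introl (corner0E _ _)).
have [|B [B1 B2 B3 B4]] := @monotone_path _ _ i k (low y) _ (levL _) ki _.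
  by left; rewrite lowE.
exists A, (low y :: B); apply/and3P; split.
- rewrite cat_path A1 A2 cat_path map_cons /= path_emb ps last_map B1 !andbT.
  apply/andP; split; apply/adjP; [left|right]; exists k; exact: step_low.
- rewrite -cat_cons cat_uniq A3 cat_uniq B3 (map_inj_uniq (can_inj (embK k))) u.
  rewrite !andbT !andTb; apply/andP; split.
    (* The first layer path has z_k <= x_k = 0, the embedded polygon z_k >= 1. The two layer paths
       are separated by z_i <= x_i and z_i >= x_i + 1. *)
    apply/hasPn => z; rewrite mem_cat => hz; apply/negP => /A4.
    case=> _ /levP zx _.
    case/orP: hz => [/map_emb_codom/emb_codom[zk _]|/B4[/levP yz _ _]].
      by have := zx k; rewrite lowE xk; lia.
    have := leq_trans (yz i) (zx i); rewrite !lowE st eqxx; lia.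
  (* The second layer path has z_k = 0 or z_i = L+1; embedded vertices have z_k >= 1 and, as i <> k,
     z_i <= L. *)
  apply/hasPn => z /B4[_ _ hz]; apply/negP.
  move=> /(@map_emb_codom _ _ k (x :: s))/emb_codom[zk zj].
  by have := zj i; rewrite eq_sym ki => /(_ isT); case: hz; rewrite ?cornerLE; lia.
- by rewrite last_cat last_cat /= B2.
Qed.

Lemma P2_le : P2 d L <= d * #|{: vertex d L.+1}| ^ 2 * C d L.+1.
Proof.
pose N := #|{: vertex d L.+1}|.
(* A decoder: the two numbers are the offset and the length of the embedded polygon in the walk.
   Every polygon counted lies in the image of [g]. *)
pose g (u : ('I_d * ('I_N * 'I_N)) * walk_space d L.+1) :=
  cycle_edges (map (unemb u.1.1) (take u.1.2.2 (drop u.1.2.1 (tagged u.2)))).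
have -> : d * #|{: vertex d L.+1}| ^ 2 * C d L.+1 =
    #|finset.setX [set: 'I_d * ('I_N * 'I_N)]%SET (walks d L.+1)|.
  by rewrite cardsX cardsT !card_prod !card_ord -C_card.
apply: leq_trans (leq_imset_card g _).
apply: subset_leq_card; apply/fintype.subsetP => E; rewrite inE.
case/andP => pE /existsP[k /andP[fE _]].
have [x [s [i [-> u ps st [xk yk]]]]] := polygon_cut pE fE.
have [p [q hp]] := polygon_to_walk u ps st xk yk.
have [t tw te] := crossing_in_walks hp.
have szN := crossing_size hp.
have sp : size p < N by move: szN; rewrite size_cat -/N; lia.
have ss : (size s).+1 < N by move: szN; rewrite !size_cat size_map /= -/N; lia.
apply/imsetP; exists ((k, (Ordinal sp, Ordinal ss)), t); first by rewrite finset.in_setX finset.in_setT.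
rewrite -[RHS]/(cycle_edges (map (unemb k)
  (take (size (x :: s)) (drop (size p) (tagged t))))).
rewrite te drop_size_cat // take_size_cat ?size_map //.
by rewrite mapK //; apply: embK.
Qed.

(** [f] reverses a monotone path from 0 to a neighbour [b] of the embedded far corner. The edge
    entering [b] lies in x_k = L+1, the edge of [f] arriving at 0 in x_k = 0. *)
Lemma closing_path (k j : 'I_d) : 0 < L -> k != j ->
  exists f : seq (vertex d L.+1),
    [/\ path (@adj d L.+1) (emb k (cornerL d L)) (rcons f (emb k (corner0 d L))),
        1 < size f /\ uniq f, {in f, forall y, y \notin codom (emb k)},
        exists2 e, e \in path_edges (emb k (cornerL d L)) f & e \subset face k ord0 &
        exists2 e, e \in path_edges (emb k (cornerL d L)) f & e \subset face k ord_max].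
Proof.
move=> L0 kj.
pose b : vertex d L.+1 := [ffun t => inord (L + ((t == k) || (t == j)))].
have bE t : b t = L + ((t == k) || (t == j)) :> nat.
  by rewrite ffunE inordK //; lia.
have lev0 : lev (corner0 d L.+1) b by apply/levP => t; rewrite corner0E.
have [q [q1 q2 q3 q4]] := @monotone_path _ _ j k _ b lev0 kj
  (or_introl (corner0E _ _)).
have bk : b k = L.+1 :> nat by rewrite bE eqxx addn1.
have bj : b j = L.+1 :> nat by rewrite bE eqxx orbT addn1.
case: q q1 q2 q3 q4 => [_ e|y q q1 q2 q3 q4].
  by move: bk; rewrite -e /= corner0E.
have fE : rev [:: corner0 d L.+1, y & q] =
    b :: rev (belast (corner0 d L.+1) (y :: q)).
  by rewrite lastI rev_rcons q2.
have lE : last b (rev (belast (corner0 d L.+1) (y :: q))) = corner0 d L.+1.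
  by rewrite -[LHS]/(last b (b :: _)) -fE rev_cons last_rcons.
have path_r : path (@adj d L.+1) b (rev (belast (corner0 d L.+1) (y :: q))).
  rewrite -q2 rev_path.
  by rewrite (eq_path (e' := @adj d L.+1)) // => u v; rewrite adj_sym.
exists (rev [:: corner0 d L.+1, y & q]); split.
- rewrite rcons_path fE last_cons lE; move: path_r; set r := rev _ => path_r.
  rewrite /= path_r andbT; apply/andP; split.
  + apply/adjP; left; exists j => t; rewrite bE embE cornerLE.
    by case: eqVneq => [->|_]; rewrite ?(negbTE kj) ?orbF ?addn0 //; case: eqP.
  + apply/adjP; left; exists k => t; rewrite embE !corner0E //.
- by rewrite rev_uniq size_rev.
- move=> z; rewrite mem_rev => /q4[_ _ hz]; apply/negP => /emb_codom[zk /(_ j)].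
  by rewrite eq_sym kj => /(_ isT); case: hz; rewrite ?bj; lia.
- exists [set y; corner0 d L.+1]%SET.
    rewrite rev_cons -cats1 rev_cons -cats1 -catA /path_edges pairmap_cat.
    by rewrite mem_cat /= !inE eqxx !orbT.
  have [_ _ hy] : [/\ lev (corner0 d L.+1) y, lev y b & y k = 0 :> nat \/ y j = b j :> nat].
    by apply: q4; rewrite !inE eqxx orbT.
  (* [y] is one step away from 0, so y_j <= 1 < L+1 as L >= 1; this leaves y_k = 0. *)
  have yk : y k = 0 :> nat.
    case: hy => // hy; case/andP: q1 => /adjP hadj _.
    case: hadj => -[i /(_ j)]; rewrite corner0E hy bj; case: eqP; lia.
  apply/fintype.subsetP => z; rewrite !inE -val_eqE => /orP[] /eqP -> /=.
    by rewrite yk.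
  by rewrite corner0E.
- exists [set emb k (cornerL d L); b]%SET; first by rewrite fE /= inE eqxx.
  apply/fintype.subsetP => z; rewrite !inE -val_eqE => /orP[] /eqP -> /=.
    by rewrite embE cornerLE eqxx addn1.
  by rewrite bk.
Qed.

Lemma C_le : 2 <= d -> 0 < L -> C d L <= P2 d L.+1.
Proof.
move=> d2 L0; pose k : 'I_d := Ordinal (ltnW d2); pose j : 'I_d := Ordinal d2.
have [f [f1 [szf f2] f3 [e0 e0f e0k] [e1 e1f e1k]]] := @closing_path k j L0 isT.
pose x0 := emb k (corner0 d L).
pose c (p : seq (vertex d L)) := map (emb k) p ++ f.
have cu p : crossing p -> uniq (x0 :: c p).
  case/and3P => _ up _; rewrite -[x0 :: c p]/(map (emb k) (_ :: p) ++ f).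
  rewrite cat_uniq (map_inj_uniq (can_inj (embK k))) up f2 andbT andTb.
  apply/hasPn => z /f3; apply: contra.
  exact: (@map_emb_codom _ _ k (_ :: p)).
have ce p : crossing p -> cycle_edges (x0 :: c p) =i
    path_edges x0 (map (emb k) p) ++ path_edges (emb k (cornerL d L)) (rcons f x0).
  move=> hp e; rewrite (cycle_edges_cons (cu p hp)) /c rcons_cat.
  rewrite /path_edges pairmap_cat last_map.
  by case/and3P: hp => _ _ /eqP ->.
have f_neq0 : f != [::] by case: (f) szf.
(* The first closing edge starts in the embedded cube, but its second endpoint is in the nonempty
   [f]; each later edge starts in [f]. *)
have outer e : e \in path_edges (emb k (cornerL d L)) (rcons f x0) ->
    ~~ (e \subset codom (emb k)).
  case: f f_neq0 f3 {f1 f2 szf e0f e1f c cu ce} => // a f _ f3; rewrite /= inE.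
  have af : a \notin codom (emb k) by apply: f3; rewrite mem_head.
  case/predU1P => [->|].
    by apply: contra af => /fintype.subsetP; apply; rewrite !inE eqxx orbT.
  apply: path_edges_not_subset => // y yf; apply: f3.
  by rewrite inE yf orbT.
have inner p e : e \in path_edges x0 (map (emb k) p) -> e \subset codom (emb k).
  move=> /path_edges_subset h; apply/fintype.subsetP => z /h.
  exact: (@map_emb_codom _ _ k (_ :: p)).
have sub p e : e \in path_edges (emb k (cornerL d L)) f -> crossing p ->
    e \in cycle_edges (x0 :: c p).
  move=> he hp; rewrite ce // mem_cat -cats1 /path_edges pairmap_cat mem_cat.
  by rewrite he orbT.
rewrite C_card.
pose h (t : walk_space d L) := cycle_edges (x0 :: c (tagged t)).
rewrite -(@card_in_imset _ _ h).
  apply: subset_leq_card; apply/fintype.subsetP => _ /imsetP[t tw ->].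
  have hp : crossing (tagged t) by move: tw; rewrite inE.
  rewrite inE; apply/andP; split.
    apply/polygonP; exists (x0 :: c (tagged t)); split=> //.
    - rewrite /= size_cat size_map ltnS.
      by apply: leq_trans szf _; rewrite leq_addl.
    - exact: cu.
    - rewrite /= rcons_cat cat_path path_emb last_map.
      by case/and3P: hp => -> _ /eqP ->.
  apply/existsP; exists k; apply/andP; split; apply/existsP.
    by exists e0; rewrite e0k andbT; apply: sub.
  by exists e1; rewrite e1k andbT; apply: sub.
move=> t t'; rewrite !inE => ht ht' /setP heq; apply: walk_space_inj.
(* The polygon determines the edge set of the embedded walk, and [path_edges_inj] then gives back
   the walk. *)
have restr p e : crossing p -> e \in path_edges x0 (map (emb k) p) =
    (e \in cycle_edges (x0 :: c p)) && (e \subset codom (emb k)).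
  move=> hp; rewrite ce // mem_cat; apply/idP/andP => [he|[/orP[//|/outer/negbTE ->//]]].
  by rewrite he (inner p).
apply: (inj_map (can_inj (embK k))); apply: (@path_edges_inj _ x0).
- by have := cu _ ht; rewrite -cat_cons cat_uniq => /andP[].
- by have := cu _ ht'; rewrite -cat_cons cat_uniq => /andP[].
- by move=> e; rewrite !restr // heq.
Qed.

End Comparison.

(** * Logarithms of the counts and the limit *)

Local Open Scope classical_set_scope.
Local Open Scope ring_scope.

(** By convention [ln 0 = 0], so monotonicity extends to m = 0 and no count has to be shown
    positive. *)
Lemma ln_nat_le (R : realType) (m n : nat) :
  (m <= n)%N -> ln (m%:R : R) <= ln n%:R.
Proof.
case: m => [_|m mn]; last by rewrite ler_ln ?posrE ?ltr0n ?ler_nat //; lia.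
case: n => [|n]; first by [].
by rewrite ln0 // ln_ge0 // ler1n.
Qed.

(** Equality can fail when one factor is 0: the left side is then 0, while the other logarithm may
    be positive. *)
Lemma ln_nat_mul (R : realType) (m n : nat) :
  ln ((m * n)%:R : R) <= ln m%:R + ln n%:R.
Proof.
have nn k : 0 <= ln (k%:R : R) by rewrite -(@ln0 R 0%:R) ?ln_nat_le.
case: m n => [|m] [|n]; rewrite ?muln0 ?mul0n ?[ln 0%:R]ln0 ?add0r ?addr0 //.
by rewrite natrM lnM ?posrE ?ltr0n.
Qed.

Lemma ln_nat_exp (R : realType) (m n : nat) :
  ln ((m ^ n)%:R : R) <= n%:R * ln m%:R.
Proof.
elim: n => [|n IH]; first by rewrite expn0 ln1 mul0r.
rewrite expnS; apply: le_trans (ln_nat_mul _ _ _) _.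
by rewrite -addn1 natrD mulrDl mul1r addrC lerD2r.
Qed.

Lemma ln_nat_bound (R : realType) (n : nat) : ln (n%:R : R) <= n%:R.
Proof.
by case: n => [|n]; [rewrite ln0 | rewrite ltW // ln_sublinear].
Qed.

(** Here N = (L+3)^d. With ln n <= n, the factor d N^2 contributes at most d + 2d(L+3) = 2dL + 7d,
    whence the 7. *)
Lemma ln_P2_le (R : realType) (d L : nat) :
  ln ((P2 d L.+1)%:R : R) <=
    7 * d%:R * L.+1%:R + ln (C d L.+2)%:R.
Proof.
apply: le_trans (ln_nat_le _ (@P2_le d L.+1)) _.
apply: le_trans (ln_nat_mul _ _ _) _; rewrite lerD2r.
apply: le_trans (ln_nat_mul _ _ _) _.
rewrite card_ffun !card_ord -expnM.
apply: le_trans (lerD (ln_nat_bound _ _) (ln_nat_exp _ _ _)) _.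
apply: (@le_trans _ _ (d%:R + (d * 2)%:R * L.+3%:R)).
  by rewrite lerD2l ler_wpM2l // ln_nat_bound.
by rewrite -!natrM -natrD ler_nat; nia.
Qed.

Theorem mainTheorem8 (R : realType) (d : nat) (d_ge2 : (2 <= d)%N)
    (lambda : R) (lambda_gt0 : 0 < lambda)
    (lambdaE : (L%:R ^+ d)^-1 * ln (C d L)%:R @[L --> \oo] --> ln lambda) :
  (L%:R ^+ d)^-1 * ln (P2 d L)%:R @[L --> \oo] --> ln lambda.
Proof.
(* After the shift, P2(L+1) is bracketed by means of C(L) and C(L+2). *)
rewrite -cvg_shiftS /=.
pose v L : R := (L%:R ^+ d)^-1 * ln (C d L)%:R.
pose h : nat -> R := harmonic.
have hE L : h L = L.+1%:R^-1 by [].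
have h0 : h x @[x --> \oo] --> (0 : R) by exact: cvg_harmonic.
have v2 : v L.+2 @[L --> \oo] --> ln lambda.
  have := lambdaE; rewrite -cvg_shiftS /= => lambdaE1.
  by rewrite -cvg_shiftS in lambdaE1.
(* For c = -1 and c = 1 these are the ratios (L/(L+1))^d and ((L+2)/(L+1))^d, which convert between
   the normalisations. *)
have lim1 (c : R) : (1 + c * h L) ^+ d @[L --> \oo] --> (1 : R).
  have : (1 + c * h L) @[L --> \oo] --> (1 + c * 0 : R).
    by apply: cvgD; [exact: cvg_cst | apply: cvgM => //; exact: cvg_cst].
  rewrite mulr0 addr0 => h1.
  have := cvg_comp _ _ h1 (@exprn_continuous R d 1).
  by rewrite expr1n.
have rescale (a b c : R) : a != 0 ->
    (a / b) ^+ d * ((a ^+ d)^-1 * c) = (b ^+ d)^-1 * c.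
  by move=> a0; rewrite expr_div_n mulrACA mulfV ?mul1r // expf_neq0.
apply: (@squeeze_cvgr _ _ _ _ (fun L => (1 + -1 * h L) ^+ d * v L)
  (fun L => 7 * d%:R * h L + (1 + 1 * h L) ^+ d * v L.+2)).
(* Both [C_le] and the cancellation of L^d require L > 0. *)
- exists 1%N => // L /= L0.
  have L1n0 : L.+1%:R != 0 :> R by rewrite pnatr_eq0.
  apply/andP; split.
    have -> : 1 + -1 * h L = L%:R / L.+1%:R.
      by rewrite hE -addn1 natrD; field; rewrite -natr1 in L1n0.
    rewrite rescale ?pnatr_eq0 -?lt0n //; apply: ler_wpM2l.
      by rewrite invr_ge0 exprn_ge0.
    by rewrite ln_nat_le // C_le.
  apply: le_trans (ler_wpM2l _ (ln_P2_le R d L)) _.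
    by rewrite invr_ge0 exprn_ge0.
  rewrite mulrDr; apply: lerD.
    rewrite mulrCA; apply: ler_wpM2l; first by rewrite mulr_ge0.
    rewrite hE mulrC.
    (* Since d >= 2, (L+1)/(L+1)^d <= 1/(L+1), so the linear error term vanishes in the limit. *)
    rewrite -(subnKC d_ge2) exprD expr2 !invfM !mulrA mulfV // mul1r ler_piMr ?invr_ge0 //.
    by rewrite invf_le1 ?exprn_gt0 // exprn_ege1 // ler1n.
  have -> : 1 + 1 * h L = L.+2%:R / L.+1%:R.
    by rewrite hE -(addn1 L.+1) natrD; field.
  by rewrite /v rescale ?pnatr_eq0.
- rewrite -[ln lambda]mul1r; apply: cvgM; [exact: lim1 | exact: lambdaE].
- have -> : ln lambda = 7 * d%:R * 0 + 1 * ln lambda :> R.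
    by rewrite mulr0 add0r mul1r.
  apply: cvgD; first by apply: cvgM => //; exact: cvg_cst.
  by apply: cvgM => //; exact: lim1.
Qed.
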